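(* For the scalar purely fast equation $u_t=\lambda u$ with $\lambda\in\mathbb C$, $\operatorname{Re}\lambda\le0$, in which the slow projector is zero ($\Pi_s=0$, $\Pi_f=1$), the SFRC one-step map with step size $h>0$ has stability function $$R^{I}_{\rm SFRC}(z)=e^z,\qquad z=h\lambda.$$ Hence $|R^{I}_{\rm SFRC}(z)|\le1$ for $\operatorname{Re}z\le0$ and $R^{I}_{\rm SFRC}(z)\to0$ as $\operatorname{Re}z\to-\infty$; that is, SFRC is L-stable.
   Context: The slow–fast response corrected (SFRC) one-step map for a linear system $U_t=LU$ with complementary spectral projectors $\Pi_s+\Pi_f=I$ commuting with $L$ is $$R_{\rm SFRC}(h)=\Pi_s S\,\Pi_s+e^{hL}\Pi_f,$$ where $S$ is the one-step matrix of a base method: for a split $L=A+B$, $$P_*=\Bigl(I-\tfrac h2B+\tfrac{h^2}{8}BL\Bigr)^{-1}\Bigl(I+\tfrac h2A+\tfrac{h^2}{8}AL\Bigr),$$ $$S=\Bigl(I-hB+\tfrac{h^2}{6}BL\Bigr)^{-1}\Bigl[I+hA+\tfrac{h^2}{6}AL+\tfrac{h^2}{3}(A-B)LP_*\Bigr].$$ In the scalar purely implicit test $A=0$, $B=\lambda$. The stability function is the scalar $R$ for which one step maps $u$ to $R(z)u$, $z=h\lambda$. L-stability here means the two displayed properties: modulus at most one on the closed left half-plane and decay to zero as $\operatorname{Re}z\to-\infty$. *)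

(* Defs.v *)
From HB Require Import structures.
From mathcomp Require Import all_boot all_order all_algebra.
From mathcomp Require Import complex.
From mathcomp Require Import all_classical all_reals all_analysis.

Set Implicit Arguments.
Unset Strict Implicit.
Unset Printing Implicit Defensive.

Import Order.TTheory GRing.Theory Num.Theory numFieldNormedType.Exports.

Local Open Scope classical_set_scope.
Local Open Scope ring_scope.
Local Open Scope complex_scope.

(* The norm topology of the numeric field R[i], which matrices over R[i] then
   inherit (R[i] itself comes without any topology). *)
HB.instance Definition _ (R : realType) := NormedModule.copy R[i] R[i]^o.

Section Exponentials.
Variable R : realType.

Definition Cexp (z : R[i]) : R[i] :=
  limn (series (fun k : nat => k`!%:R^-1 * z ^+ k)).

Definition expmx n (M : 'M[R[i]]_n) : 'M[R[i]]_n :=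
  limn (series (fun k : nat => k`!%:R^-1 *: M ^+ k)).

End Exponentials.

(* One step of size h for U_t = L U with the splitting L = A + B. *)
Section OneStepMaps.
Variables (R : realType) (n : nat) (h : R) (A B : 'M[R[i]]_n).
Let L := A + B.
Let hC : R[i] := h%:C.

Definition predictor : 'M[R[i]]_n :=
  invmx (1%:M - (hC / 2) *: B + (hC ^+ 2 / 8) *: (B *m L))
  *m (1%:M + (hC / 2) *: A + (hC ^+ 2 / 8) *: (A *m L)).

Definition base_step : 'M[R[i]]_n :=
  invmx (1%:M - hC *: B + (hC ^+ 2 / 6) *: (B *m L))
  *m (1%:M + hC *: A + (hC ^+ 2 / 6) *: (A *m L)
      + (hC ^+ 2 / 3) *: ((A - B) *m L *m predictor)).

Definition sfrc_step (Pslow Pfast : 'M[R[i]]_n) : 'M[R[i]]_n :=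
  Pslow *m base_step *m Pslow + expmx (hC *: L) *m Pfast.

End OneStepMaps.

Section Stability.
Variable R : realType.

(* The scalar test u_t = lambda u with A = 0, B = lambda, treated as a 1 x 1
   system that is entirely fast. *)
Definition sfrc_purely_fast (h : R) (lambda : R[i]) : 'M[R[i]]_1 :=
  sfrc_step h 0 lambda%:M 0 1%:M.

(* [step h lambda] is the one-step matrix for u_t = lambda u, step size h. *)
Definition is_stability_function
    (step : R -> R[i] -> 'M[R[i]]_1) (Rstab : R[i] -> R[i]) : Prop :=
  forall (h : R) (lambda : R[i]), 0 < h -> complex.Re lambda <= 0 ->
  forall u : 'cV[R[i]]_1, step h lambda *m u = Rstab (h%:C * lambda) *: u.

(* The filter of Re z --> -oo, with no constraint on Im z. *)
Definition Re_ninfty : set_system R[i] :=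
  filter_from setT (fun M : R => [set z : R[i] | complex.Re z < M]).

Definition L_stable (Rstab : R[i] -> R[i]) : Prop :=
  (forall z : R[i], complex.Re z <= 0 -> `|Rstab z| <= 1) /\
  Rstab z @[z --> Re_ninfty] --> (0 : R[i]).

End Stability.

(* Main.v *)
Require Import Defs.
From mathcomp Require Import all_boot all_order all_algebra.
From mathcomp Require Import complex ring.
From mathcomp Require Import all_classical all_reals all_analysis.

(** With a vanishing slow projector the step matrix is the matrix exponential of
    the 1 x 1 matrix h lambda, and for 1 x 1 matrices the exponential series is
    the scalar one entry by entry ([expmx_scalar1]), so the stability function
    is [Cexp]. Both halves of L-stability then follow from the single identity
    |exp z| = exp (Re z) ([norm_Cexp]): the real exponential is at most 1 on
    nonpositive numbers, and it is below any e > 0 left of ln e.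

    The complex exponential is only known as the limit of its series, so this
    identity needs a proof. It is obtained along the real ray t |-> exp (t z).
    For a complex weight w, the function t |-> Re (w exp (t z)) is a real power
    series in t ([re_exp]), to which termwise differentiation applies:
    differentiating replaces w by w z ([is_derive_re_exp]). The weights 1 and i
    give the real part and minus the imaginary part of exp (t z), and by real
    linearity in w ([re_exp_decomp]) their derivatives are combinations of the
    two functions themselves. The squared modulus N then satisfies
    N' = 2 (Re z) N and N 0 = 1, hence N t = exp (2 (Re z) t)
    ([re_exp_sqr]). *)

Set Implicit Arguments.
Unset Strict Implicit.
Unset Printing Implicit Defensive.

Import Order.TTheory GRing.Theory Num.Theory numFieldNormedType.Exports.
Import Normc.

Local Open Scope classical_set_scope.
Local Open Scope ring_scope.
Local Open Scope complex_scope.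

Lemma normrC_normc (R : realType) (z : R[i]) : `|z| = (normc z)%:C.
Proof. by rewrite normc_def; case: z. Qed.

Lemma normcX (R : realType) (z : R[i]) n : normc (z ^+ n) = normc z ^+ n.
Proof.
elim: n => [|n IHn]; first by rewrite !expr0 normc1.
by rewrite !exprS normcM IHn.
Qed.

Lemma norm_Re_le_normc (R : realType) (z : R[i]) : `|complex.Re z| <= normc z.
Proof. by have := normc_ge_Re z; rewrite normrC_normc lecR. Qed.

Lemma cvg_complex (R : realType) (T : Type) (F : set_system T) (f : T -> R[i])
    (x y : R) : Filter F ->
  complex.Re (f t) @[t --> F] --> x -> complex.Im (f t) @[t --> F] --> y ->
  f t @[t --> F] --> (x +i* y : R[i]).
Proof.
(* In R[i], 0 < e means that e is real and positive. *)
move=> FF cx cy; apply/cvgrPdist_lt => -[e e'].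
rewrite ltcE /= => /andP[/eqP-> e_gt0].
have e2 : 0 < e / 2 by rewrite divr_gt0.
move/cvgrPdist_lt/(_ _ e2): cx => cx; move/cvgrPdist_lt/(_ _ e2): cy => cy.
near=> t.
rewrite normrC_normc (_ : _ +i* 0 = e%:C)// ltcR.
have -> : (x +i* y) - f t =
    (x - complex.Re (f t))%:C + (y - complex.Im (f t))%:C * 'i%C.
  by case: (f t) => a b /=; simpc.
apply: le_lt_trans (le_normcD _ _) _; rewrite normcM.
rewrite [normc 'i%C]/= expr0n expr1n /= add0r sqrtr1 mulr1.
rewrite /= !expr0n /= !addr0 !sqrtr_sqr [e]splitr ltrD//.
- by near: t.
- by near: t.
Unshelve. all: by end_near. Qed.

Lemma Re_mul_real_linear (R : realType) (w x : R[i]) :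
  complex.Re (w * x) =
  complex.Re w * complex.Re x + complex.Im w * complex.Re ('i%C * x).
Proof. by case: w x => [a b] [c d] /=; ring. Qed.

Section ReExp.
Variables (R : realType) (z : R[i]).

Definition re_coeff (w : R[i]) (n : nat) : R :=
  complex.Re (w * z ^+ n) / n`!%:R.

(** The function Re (w exp (t z)). The weight w lets one family of real power
    series hold both coordinates of exp (t z) (w = 1 and w = i) and all their
    derivatives. *)
Definition re_exp (w : R[i]) (t : R) : R := limn (pseries (re_coeff w) t).

Lemma is_cvg_re_exp w t : cvgn (pseries (re_coeff w) t).
Proof.
apply: normed_cvg.
(* Compare with |w| exp (|z| |t|). *)
apply: (@series_le_cvg _ _
  (fun n => normc w * exp_coeff (normc z * `|t|) n)).
- by move=> n /=.
- move=> n /=; rewrite mulr_ge0 ?exp_coeff_ge0 ?mulr_ge0//.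
    exact: le_trans (normr_ge0 _) (norm_Re_le_normc w).
  exact: le_trans (normr_ge0 _) (norm_Re_le_normc z).
- move=> n /=; rewrite /exp_coeff /= exprMn !normrM normrX normfV.
  rewrite [`|_%:R|]ger0_norm//.
  rewrite [leRHS](_ : _ = normc w * normc z ^+ n / n`!%:R * `|t| ^+ n);
    last by ring.
  rewrite ler_wpM2r ?exprn_ge0// ler_wpM2r ?invr_ge0//.
  by rewrite -normcX -normcM norm_Re_le_normc.
- exact/is_cvg_seriesZ/is_cvg_series_exp_coeff.
Qed.

(** The shift of index in the derived series turns z ^ (n + 1) / n! into a
    coefficient of the same family, the extra factor z being absorbed by the
    weight. *)
Lemma pseries_diffs_re_coeff w : pseries_diffs (re_coeff w) = re_coeff (w * z).
Proof.
apply/funext => n; rewrite /pseries_diffs /re_coeff factS natrM invfM exprS mulrA.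
by rewrite mulrCA mulVKf.
Qed.

Lemma is_derive_re_exp w (t : R) : is_derive t 1 (re_exp w) (re_exp (w * z) t).
Proof.
rewrite /re_exp -pseries_diffs_re_coeff.
(* Any point of modulus greater than |t| would do, since the series converges
   everywhere. *)
apply: (@pseries_snd_diffs _ _ (`|t| + 1)); rewrite ?pseries_diffs_re_coeff;
  try exact: is_cvg_re_exp.
by rewrite [`|_ + 1|]ger0_norm ?ltrDl// addr_ge0.
Qed.

(** This closes the system of differential equations: the derivatives, which
    have weights z and i z, become combinations of the weights 1 and i. *)
Lemma re_exp_decomp w t :
  re_exp w t = complex.Re w * re_exp 1 t + complex.Im w * re_exp 'i%C t.
Proof.
apply: cvg_lim => //.
rewrite [X in X @ _](_ : _ = fun n => complex.Re w * pseries (re_coeff 1) t n +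
    complex.Im w * pseries (re_coeff 'i%C) t n); last first.
  apply/funext => n; rewrite /pseries /series /= !mulr_sumr -big_split /=.
  by apply: eq_bigr => k _; rewrite /re_coeff Re_mul_real_linear mul1r; ring.
by apply: cvgD; apply: cvgMr; exact: is_cvg_re_exp.
Qed.

Lemma re_exp0 w : re_exp w 0 = complex.Re w.
Proof.
apply: lim_near_cst => //; near=> n.
have n0 : (0 < n)%N by near: n; exists 1%N.
rewrite /pseries /series /= -(prednK n0) big_nat_recl//= big1 => [|i _].
  by rewrite /re_coeff !expr0 !mulr1 fact0 divr1 addr0.
by rewrite expr0n mulr0.
Unshelve. all: by end_near. Qed.

(** The squared modulus of exp (t z) satisfies N' = 2 (Re z) N, because the cross
    terms in Im z cancel; so N t * exp (- 2 (Re z) t) has derivative zero and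
    keeps its value 1 at t = 0. *)
Lemma re_exp_sqr t :
  re_exp 1 t ^+ 2 + re_exp 'i%C t ^+ 2 = expR (2 * complex.Re z * t).
Proof.
pose N := re_exp 1 ^+ 2 + re_exp 'i%C ^+ 2.
have NE s : N s = re_exp 1 s ^+ 2 + re_exp 'i%C s ^+ 2 by rewrite /N !fctE.
rewrite -NE; set a := complex.Re z.
pose G := N * (expR \o (- (2 * a) \*: id)).
have GE s : G s = N s * expR (- (2 * a) * s) by rewrite /G fctE.
have : G t = G 0.
  apply: is_derive_0_is_cst => s.
  have d1 := is_derive_re_exp 1 s; have d2 := is_derive_re_exp 'i%C s.
  apply: is_derive_eq.
  rewrite /GRing.scale /= (re_exp_decomp (1 * z)) (re_exp_decomp ('i%C * z)).
  by rewrite NE /a; case: (z) => x y /=; ring.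
rewrite !GE (NE 0) !re_exp0 /= mulr0 expR0 expr1n expr0n /= addr0 mulr1.
by rewrite mulNr expRN => /divr1_eq.
Qed.

End ReExp.

(** The imaginary part comes from the weight i through Im x = - Re (i x), whence
    the minus sign. *)
Lemma cvg_Cexp (R : realType) (z : R[i]) :
  series (fun k : nat => k`!%:R^-1 * z ^+ k) n @[n --> \oo] -->
  (re_exp z 1 1 -i* re_exp z 'i%C 1 : R[i]).
Proof.
have natC k : (k%:R^-1 : R[i]) = (k%:R^-1 : R)%:C by rewrite fmorphV rmorph_nat.
apply: cvg_complex.
- rewrite [X in X @ _](_ : _ = pseries (re_coeff z 1) 1).
    exact: is_cvg_re_exp.
  apply/funext => n; rewrite /pseries /series /=.
  rewrite (big_morph (@complex.Re R) (id1 := 0) (op1 := +%R))//;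
    last by case=> ? ? [].
  apply: eq_bigr => k _; rewrite /re_coeff expr1n mulr1 mul1r natC.
  by case: (z ^+ k) => a b /=; ring.
- rewrite [X in X @ _](_ : _ = - pseries (re_coeff z 'i%C) 1).
    by apply: cvgN; exact: is_cvg_re_exp.
  apply/funext => n; rewrite /pseries /series fctE /= -sumrN.
  rewrite (big_morph (@complex.Im R) (id1 := 0) (op1 := +%R))//;
    last by case=> ? ? [].
  apply: eq_bigr => k _; rewrite /re_coeff expr1n mulr1 natC.
  by case: (z ^+ k) => a b /=; ring.
Qed.

Arguments cvg_Cexp {R} z.

Lemma CexpE (R : realType) (z : R[i]) :
  Cexp z = re_exp z 1 1 -i* re_exp z 'i%C 1.
Proof.
by apply: cvg_lim (cvg_Cexp z); exact: norm_hausdorff.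
Qed.

Lemma norm_Cexp (R : realType) (z : R[i]) : `|Cexp z| = (expR (complex.Re z))%:C.
Proof.
rewrite CexpE normc_def /= sqrrN re_exp_sqr mulr1.
by rewrite expRM_natl sqrtr_sqr ger0_norm ?expR_ge0.
Qed.

(** Scalar matrices form a ring isomorphic to R[i], so the partial sums are the
    scalar partial sums on the diagonal, and matrix balls are entrywise. *)
Lemma expmx_scalar1 (R : realType) (z : R[i]) :
  expmx (z%:M : 'M[R[i]]_1) = (Cexp z)%:M.
Proof.
apply: cvg_lim; first exact: norm_hausdorff.
rewrite [X in X @ _](_ : _ = fun n =>
    (series (fun k : nat => k`!%:R^-1 * z ^+ k) n)%:M); last first.
  apply/funext => n; rewrite /series /= raddf_sum /=.
  by apply: eq_bigr => k _; rewrite -rmorphXn /= scale_scalar_mx.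
have /cvg_ballP cz := cvg_Cexp z; rewrite -CexpE in cz.
apply/cvg_ballP => e e0; near=> n; split=> // i j.
rewrite !ord1 !mxE eqxx !mulr1n.
by near: n; exact: cz.
Unshelve. all: by end_near. Qed.

Theorem proposition3p5 (R : realType) :
  is_stability_function (@sfrc_purely_fast R) (@Cexp R) /\ L_stable (@Cexp R).
Proof.
split; [|split].
- move=> h l _ _ u.
  rewrite /sfrc_purely_fast /sfrc_step mul0mx mul0mx add0r add0r mulmx1.
  by rewrite scale_scalar_mx expmx_scalar1 mul_scalar_mx.
- move=> z z0; rewrite norm_Cexp lecE /= eqxx /=.
  by rewrite -expR0 ler_expR.
- have FF : Filter (@Re_ninfty R).
    apply: filter_from_filter; first by exists 0.
    move=> a b _ _; exists (Num.min a b) => // z /=.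
    by rewrite lt_min => /andP[].
  apply/cvgr0Pnorm_lt => -[e e']; rewrite ltcE /= => /andP[/eqP-> e0].
  exists (ln e) => // z /= ze.
  rewrite norm_Cexp (_ : _ +i* 0 = e%:C)// ltcR.
  by rewrite -[ltRHS](@lnK R) ?posrE// ltr_expR.
Qed.
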